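(* For any path $\omega\in\Omega$, the set $\mathcal{I}_{\mathrm{S}}(\omega)$ of all interval forecasts that make $\omega$ Schnorr random is closed under (finite) intersections: for any two interval forecasts $I$ and $J$ in $\mathcal{I}_{\mathrm{S}}(\omega)$, we have that $I\cap J\in\mathcal{I}_{\mathrm{S}}(\omega)$ (in particular, $I\cap J\neq\emptyset$).
   Context: Notation: $\mathbb{N}=\{1,2,\dots\}$, $\mathbb{N}_0=\mathbb{N}\cup\{0\}$. Situations are the finite binary sequences $\mathbb{S}=\bigcup_{n\in\mathbb{N}_0}\{0,1\}^n$, with $\square$ the empty sequence; $sx$ is $s$ with $x\in\{0,1\}$ appended. Paths are elements $\omega$ of $\Omega=\{0,1\}^{\mathbb{N}}$; $\omega_{1:n}\in\mathbb{S}$ consists of the first $n$ entries. $\mathcal{I}$ is the set of non-empty closed subintervals of $[0,1]$ (interval forecasts). For $f\colon\{0,1\}\to\mathbb{R}$ and $I\in\mathcal{I}$, $\overline{E}_I(f)=\max_{p\in I}[pf(1)+(1-p)f(0)]$. A forecasting system is a map $\varphi\colon\mathbb{S}\to\mathcal{I}$. For $I\in\mathcal{I}$, the stationary forecasting system $\gamma_I$ is given by $\gamma_I(s)=I$ for all $s\in\mathbb{S}$. A real process is a map $F\colon\mathbb{S}\to\mathbb{R}$, with $\Delta F(s)(x)=F(sx)-F(s)$. A test process is a non-negative real process with $F(\square)=1$. A supermartingale for $\varphi$ is a real process $M$ with $\overline{E}_{\varphi(s)}(\Delta M(s))\le 0$ for all $s\in\mathbb{S}$; a test supermartingale for $\varphi$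 is a test process that is a supermartingale for $\varphi$. ''Recursive'' means computable by a Turing machine (countable sets such as $\mathbb{S}$ and $\mathbb{S}\times\mathbb{N}_0$ are identified with $\mathbb{N}_0$ by recursive bijections with recursive inverse). A real process $F$ is computable if there are a recursive family of rationals $r_{s,n}$ and a recursive map $e\colon\mathbb{S}\times\mathbb{N}_0\to\mathbb{N}_0$ such that $n\ge e(s,N)$ implies $|r_{s,n}-F(s)|\le 2^{-N}$. A growth function is a recursive, non-decreasing, unbounded map $\rho\colon\mathbb{N}_0\to\mathbb{N}_0$. A path $\omega$ is Schnorr random for $\varphi$ if $\limsup_{n\to\infty}[T(\omega_{1:n})-\rho(n)]\le 0$ for all computable test supermartingales $T$ for $\varphi$ and all growth functions $\rho$. $\mathcal{I}_{\mathrm{S}}(\omega)=\{I\in\mathcal{I}:\omega\text{ is Schnorr random for }\gamma_I\}$. *)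

(* Defs.v *)
(* The real numbers are an arbitrary R : realType. *)
From HB Require Import structures.
From mathcomp Require Import all_boot all_order all_algebra.
From mathcomp Require Import all_classical all_reals all_analysis.
From mathcomp Require Import zify ring lra.

Set Implicit Arguments.
Unset Strict Implicit.
Unset Printing Implicit Defensive.

Import Order.TTheory GRing.Theory Num.Theory.

Local Open Scope classical_set_scope.
Local Open Scope ring_scope.

Section TuringMachines.

Inductive direction := MoveLeft | MoveRight | Stay.

(* Deterministic machines with finitely many states, a finite alphabet and    *)
(* tm_extra.+1 two-way infinite tapes. The machine halts when tm_delta        *)
(* returns None.                                                              *)
Record turing_machine := TuringMachine {
  tm_extra : nat;
  tm_symbol : finType;
  tm_blank : tm_symbol;
  tm_stroke : tm_symbol;
  tm_stroke_neq_blank : tm_stroke != tm_blank;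
  tm_state : finType;
  tm_start : tm_state;
  tm_delta : tm_state -> {ffun 'I_tm_extra.+1 -> tm_symbol} ->
    option (tm_state * ('I_tm_extra.+1 -> tm_symbol * direction))
}.

Variable M : turing_machine.

(* Cells are indexed relatively to the head, which always scans cell 0.       *)
Definition tm_tape := int -> tm_symbol M.

Definition tm_config : Type := tm_state M * ('I_(tm_extra M).+1 -> tm_tape).

Definition tm_write (t : tm_tape) (a : tm_symbol M) : tm_tape :=
  fun z => if z == 0 then a else t z.

Definition tm_move (t : tm_tape) (d : direction) : tm_tape :=
  match d with
  | MoveLeft => fun z => t (z - 1)
  | MoveRight => fun z => t (z + 1)
  | Stay => t
  end.

Definition tm_step (c : tm_config) : option tm_config :=
  if tm_delta c.1 [ffun i => c.2 i 0] is Some (q, act) then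
    Some (q, fun i => tm_move (tm_write (c.2 i) (act i).1) (act i).2)
  else None.

(* The number n is represented by n consecutive strokes on the first tape,    *)
(* whose head scans the leftmost of them; all other cells are blank.          *)
Definition tm_standard (n : nat) : 'I_(tm_extra M).+1 -> tm_tape :=
  fun i z => if (i == ord0) && (0 <= z < n%:Z) then tm_stroke M else tm_blank M.

Definition tm_computes (g : nat -> nat) : Prop :=
  forall n : nat, exists (k : nat) (c : tm_config),
    [/\ iter k (obind tm_step) (Some (tm_start M, tm_standard n)) = Some c,
        tm_step c = None &
        forall i z, c.2 i z = tm_standard (g n) i z].

End TuringMachines.

Section Recursiveness.

Definition recursive (g : nat -> nat) : Prop :=
  exists M : turing_machine, tm_computes M g.

(* Situations are finite binary sequences, the first outcome coming first.    *)
Definition situation := seq bool.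

(* The usual numbering 0 <-> [::], 1 <-> 0, 2 <-> 1, 3 <-> 00, 4 <-> 01, ...  *)
Definition code_situation (s : situation) : nat :=
  foldl (fun (c : nat) (x : bool) => (c.*2 + x + 1)%N) 0%N s.

Definition cantor_pair (m n : nat) : nat := ('C((m + n).+1, 2) + n)%N.

Definition recursive_SN (f : situation -> nat -> nat) : Prop :=
  exists2 g : nat -> nat, recursive g &
    forall s n, f s n = g (cantor_pair (code_situation s) n).

Definition recursive_rat_family (r : situation -> nat -> rat) : Prop :=
  exists a b sg : situation -> nat -> nat,
    [/\ recursive_SN a, recursive_SN b, recursive_SN sg,
        forall s n, (0 < b s n)%N &
        forall s n, r s n = (-1) ^+ sg s n * ((a s n)%:R / (b s n)%:R)].

Lemma code_situation_rcons s x :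
  code_situation (rcons s x) = ((code_situation s).*2 + x + 1)%N.
Proof. by rewrite /code_situation foldl_rcons. Qed.

Lemma code_situation_inj : injective code_situation.
Proof.
elim/last_ind=> [|s x IHs]; elim/last_ind=> [|t y _] //;
  rewrite ?code_situation_rcons; [rewrite {1}/code_situation /=; lia|
  rewrite {2}/code_situation /=; lia|move=> e].
have [/IHs -> ->] // : code_situation s = code_situation t /\ x = y.
by case: x y e => [] []; split=> //; lia.
Qed.

Lemma code_situation_surj n : exists s, code_situation s = n.
Proof.
elim/ltn_ind: n => -[_|n IHn]; first by exists [::].
have [|s es] := IHn n./2; first by lia.
by exists (rcons s (odd n)); rewrite code_situation_rcons es; lia.
Qed.

Lemma cantor_pair_surj k : exists m n, cantor_pair m n = k.
Proof.
rewrite /cantor_pair; elim: k => [|k [[|m] [n <-]]]; first by exists 0%N, 0%N.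
- by exists n.+1, 0%N; rewrite !addn0 add0n (binS n.+1 1) bin1; lia.
- by exists m, n.+1; rewrite addnS addSn addnS.
Qed.

Lemma cantor_pair_inj m n m' n' :
  cantor_pair m n = cantor_pair m' n' -> m = m' /\ n = n'.
Proof.
have lt_pair a b c d : (a + b < c + d)%N -> (cantor_pair a b < cantor_pair c d)%N.
  move=> lt_s; have := leq_bin2l 2 (lt_s : ((a + b).+1 < (c + d).+1)%N).
  by rewrite /cantor_pair (binS (a + b).+1 1) bin1; lia.
have [/lt_pair|/lt_pair|eq_s] := ltngtP (m + n)%N (m' + n')%N; try lia.
by rewrite /cantor_pair eq_s; lia.
Qed.

End Recursiveness.

Section Forecasting.

Variable R : realType.

Record interval_forecast := IntervalForecast {
  forecast_set :> set R;
  _ : exists a b : R, [/\ 0 <= a, a <= b, b <= 1 & forecast_set = `[a, b]%classic]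
}.

Definition local_expectation (p : R) (f : bool -> R) : R :=
  p * f true + (1 - p) * f false.

(* The supremum is a maximum, see upper_expectation_max.                      *)
Definition upper_expectation (I : interval_forecast) (f : bool -> R) : R :=
  sup [set local_expectation p f | p in (I : set R)].

Lemma upper_expectation_max (I : interval_forecast) (f : bool -> R) :
  (exists2 p, (I : set R) p & upper_expectation I f = local_expectation p f) /\
  (forall p, (I : set R) p -> local_expectation p f <= upper_expectation I f).
Proof.
have [p Ip maxp] : exists2 p, (I : set R) p &
    forall q, (I : set R) q -> local_expectation q f <= local_expectation p f.
  case: I => _ /= [a [b [a0 ab b1 ->]]]; rewrite /local_expectation.
  have [le_f|lt_f] := leP (f false) (f true); [exists b|exists a];
    rewrite /= ?in_itv /= ?ab ?lexx // => q; rewrite in_itv /= => /andP[aq qb];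
    nra.
have eq_sup : upper_expectation I f = local_expectation p f.
  apply/eqP; rewrite eq_le; apply/andP; split.
    apply: ge_sup; first by exists (local_expectation p f), p.
    by move=> _ [q Iq <-]; apply: maxp.
  apply: ub_le_sup; last by exists p.
  by exists (local_expectation p f) => _ [q Iq <-]; apply: maxp.
by split; [exists p | rewrite eq_sup].
Qed.

Definition forecasting_system := situation -> interval_forecast.

Definition stationary (I : interval_forecast) : forecasting_system := fun=> I.

Definition real_process := situation -> R.

Definition process_difference (F : real_process) (s : situation) (x : bool) : R :=
  F (rcons s x) - F s.

Definition test_process (F : real_process) : Prop :=
  (forall s, 0 <= F s) /\ F [::] = 1.

Definition supermartingale (phi : forecasting_system) (M : real_process) : Prop :=
  forall s, upper_expectation (phi s) (process_difference M s) <= 0.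

Definition test_supermartingale (phi : forecasting_system) (M : real_process) :
  Prop := test_process M /\ supermartingale phi M.

Definition computable_process (F : real_process) : Prop :=
  exists (r : situation -> nat -> rat) (e : situation -> nat -> nat),
    [/\ recursive_rat_family r, recursive_SN e &
        forall s N n, (e s N <= n)%N -> `|ratr (r s n) - F s| <= 2 ^- N].

Definition growth_function (rho : nat -> nat) : Prop :=
  [/\ recursive rho,
      forall m n, (m <= n)%N -> (rho m <= rho n)%N &
      forall B : nat, exists n, (B < rho n)%N].

(* The n-th entry of a path (n >= 1) is omega n.-1, so that the first n       *)
(* entries are mkseq omega n.                                                 *)
Definition binary_path := nat -> bool.

(* The upper limit is taken in the extended reals.                            *)
Definition schnorr_random (phi : forecasting_system) (omega : binary_path) : Prop :=
  forall (T : real_process) (rho : nat -> nat),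
    computable_process T -> test_supermartingale phi T -> growth_function rho ->
    (limn_esup (fun n => (T (mkseq omega n) - (rho n)%:R)%:E) <= 0)%E.

Definition schnorr_forecasts (omega : binary_path) : set interval_forecast :=
  [set I | schnorr_random (stationary I) omega].

End Forecasting.

(* Main.v *)
(* If b = max I < c = min J, take rationals b < p1 < p2 < c and a small xi:    *)
(* betting on the outcome x with the factors 1 + xi (x - p1) and              *)
(* 1 - xi (x - p2) gives test supermartingales for I and J whose product      *)
(* grows exponentially, so that one of them outgrows a growth function        *)
(* infinitely often.                                                          *)
(* If I and J overlap, let T be a test supermartingale for their intersection *)
(* K, replaced by a rational-valued supermartingale above it. A difference    *)
(* that increases with the outcome is constrained only by the upper bound of  *)
(* K, the other ones only by its lower bound. So T / T([::]) is the product   *)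
(* of two computable test supermartingales, one betting only on increasing    *)
(* differences, the other one only on the remaining ones, and these are test  *)
(* supermartingales for I and J. If T exceeds rho infinitely often, one of    *)
(* them exceeds a growth function of the order of the square root of rho.     *)
(* The computability of all this rests on the closure of Turing computable    *)
(* functions under composition, pairing and iteration, obtained by compiling  *)
(* register programs with subroutine calls to machines with one tape per      *)
(* register.                                                                  *)
Require Import Defs.
From HB Require Import structures.
From mathcomp Require Import all_boot all_order all_algebra.
From mathcomp Require Import all_classical all_reals all_analysis.
From mathcomp Require Import zify ring lra.

Set Implicit Arguments.
Unset Strict Implicit.
Unset Printing Implicit Defensive.

Import Order.TTheory GRing.Theory Num.Theory.

Local Open Scope classical_set_scope.
Local Open Scope ring_scope.

(** * Programs on multi-tape Turing machines *)

(** Randomness for [I] and [J] enters only through [schnorr_product_lt]: for computable test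
    supermartingales [U] for [I] and [V] for [J], the quantity [C * (U * V)] is eventually below any
    growth function [rho] along [omega], since each factor is eventually below one of the order of
    the square root of [rho / C]. It then suffices to exhibit a product that is large.

    A gap between the intervals is an arbitrage ([schnorr_not_disjoint]): one bettor backs a success
    probability above [I], the other one below [J], and whatever the outcome their joint capital is
    multiplied by a constant above 1.

    For crossing intervals ([schnorr_overlapping]), the mean of an increasing difference is largest
    at the upper end of the intersection, which is also the upper end of one interval; that of a
    decreasing difference is largest at the lower end, inherited from the other interval.
    Attributing each multiplicative step to one side factors a supermartingale for the intersection.
    This needs positive values that can be compared exactly, hence [rational_majorant]. For nested
    intervals the intersection is one of them.

    The capital processes are products of recursive fractions along prefixes, computable by
    [recursive_path_product], which rests on [recursive_program] and [recursive_iter]. *)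

Section Fragments.

Variables (N : nat) (G : finType) (blank stroke : G).
Hypothesis stroke_neq_blank : stroke != blank.

Local Notation tapes := ('I_N.+1 -> int -> G).
Local Notation action := ('I_N.+1 -> G * direction).
Local Notation scanned := {ffun 'I_N.+1 -> G}.

(** Tapes and alphabet are fixed outside the record, so that programs compose by taking sums of
    their state types. *)
Record fragment := Fragment {
  fstate : finType;
  fstart : fstate;
  fdelta : fstate -> scanned -> option (fstate * action)
}.

Definition machine_of (P : fragment) : turing_machine :=
  TuringMachine stroke_neq_blank (fstart P) (@fdelta P).

Definition scan (t : tapes) : scanned := [ffun i => t i 0].

Definition move_tape (u : int -> G) (d : direction) : int -> G :=
  match d with
  | MoveLeft => fun z => u (z - 1)
  | MoveRight => fun z => u (z + 1)
  | Stay => u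
  end.

Definition act_on (t : tapes) (a : action) : tapes :=
  fun i => move_tape (fun z => if z == 0 then (a i).1 else t i z) (a i).2.

Inductive steps (P : fragment) : fstate P -> tapes -> fstate P -> tapes -> Prop :=
| steps_refl q t : steps q t q t
| steps_cons q t q1 a q2 t2 : fdelta q (scan t) = Some (q1, a) ->
    steps q1 (act_on t a) q2 t2 -> steps q t q2 t2.

Lemma steps_trans P (q : fstate P) t q1 t1 q2 t2 :
  steps q t q1 t1 -> steps q1 t1 q2 t2 -> steps q t q2 t2.
Proof.
move=> st; elim: st q2 t2 => {q t q1 t1} // q t q1 a q2 t2 e _ IH q3 t3 st3.
exact: steps_cons e (IH _ _ st3).
Qed.

Definition runs (P : fragment) (t t' : tapes) : Prop :=
  exists2 q, steps (fstart P) t q t' & fdelta q (scan t') = None.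

Lemma steps_iter P (q : fstate P) t q' t' : steps q t q' t' ->
  exists k, iter k (obind (@tm_step (machine_of P))) (Some (q, t)) = Some (q', t').
Proof.
elim=> {q t q' t'} [q t|q t q1 a q2 t2 e _ [k IH]]; first by exists 0%N.
exists k.+1; rewrite iterSr -IH /=; congr iter.
by rewrite /tm_step /= -/(scan t) e.
Qed.

Lemma steps_embed P Q (e : fstate P -> fstate Q) :
  (forall q v q' a, fdelta q v = Some (q', a) ->
     fdelta (e q) v = Some (e q', a)) ->
  forall q t q' t', steps q t q' t' -> steps (e q) t (e q') t'.
Proof.
move=> eP q t q' t'; elim=> {q t q' t'} [q t|q t q1 a q2 t2 /eP eq_d _].
  exact: steps_refl.
exact: steps_cons.
Qed.

Definition idle (v : scanned) : action := fun i => (v i, Stay).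

Lemma act_idle t : act_on t (idle (scan t)) = t.
Proof.
apply/funext => i; apply/funext => z; rewrite /act_on /= ffunE.
by case: eqP => [->|].
Qed.

(** The default 0 of [nth] makes every tape beyond the list blank, so scratch tapes need not be
    listed. *)
Definition unary (s : seq nat) : tapes :=
  fun i z => if 0 <= z < (nth 0%N s i)%:Z then stroke else blank.

Lemma scan_unary s i : (scan (unary s) i == blank) = (nth 0%N s i == 0%N).
Proof.
rewrite ffunE /unary lexx /=; case: (nth 0%N s i) => [|n] /=; first by rewrite eqxx.
by rewrite (negbTE stroke_neq_blank).
Qed.

Definition realizes (P : fragment) (s s' : seq nat) := runs P (unary s) (unary s').

Definition fskip : fragment :=
  @Fragment unit tt (fun _ _ => None).

Lemma realizes_skip s : realizes fskip s s.
Proof. by exists tt => //; exact: steps_refl. Qed.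

(** The new stroke goes to the left of the block. A transition writes before it moves, hence two of
    them: one to step left, one to write. *)
Definition finc (i : nat) : fragment :=
  @Fragment (option bool) (Some true) (fun q v =>
    match q with
    | Some true =>
        Some (Some false, fun j : 'I_N.+1 => (v j, if j == i :> nat then MoveLeft else Stay))
    | Some false =>
        Some (None, fun j : 'I_N.+1 => (if j == i :> nat then stroke else v j, Stay))
    | None => None
    end).

Lemma realizes_inc i s :
  realizes (finc i) s (set_nth 0%N s i (nth 0%N s i).+1).
Proof.
exists None => //.
do 2 apply: steps_cons => //.
set t := act_on _ _.
suff -> : t = unary (set_nth 0%N s i (nth 0%N s i).+1) by exact: steps_refl.
apply/funext => j; apply/funext => z; rewrite /t /act_on /= !ffunE /unary nth_set_nth /=.
have [ji|//] := eqVneq (j : nat) i; last first.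
  by rewrite /=; case: (z =P 0) => [->|].
rewrite /= ji; case: (z =P 0) => [->|nz] //=.
have -> : (0 <= z - 1 < (nth 0%N s i)%:Z) = (0 <= z < (nth 0%N s i).+1%:Z) by lia.
by case: (z - 1 =P 0) => // z1; rewrite (_ : z = 1) //; lia.
Qed.

Definition decrement (i : nat) (v : scanned) : action :=
  fun j : 'I_N.+1 => if j == i :> nat then (blank, MoveRight) else (v j, Stay).

Lemma act_decrement i s :
  act_on (unary s) (decrement i (scan (unary s))) =
  unary (set_nth 0%N s i (nth 0%N s i).-1).
Proof.
apply/funext => j; apply/funext => z.
rewrite /act_on /decrement /= !ffunE /unary nth_set_nth /=.
have [ji|//] := eqVneq (j : nat) i; last by rewrite /=; case: (z =P 0) => [->|].
rewrite /= ji; case: ifP => h; case: ifP => h' //; try lia.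
  by case: ifP => //; lia.
by case: ifP => //; lia.
Qed.

Definition is_blank_at (i : nat) (v : scanned) : bool :=
  [exists j : 'I_N.+1, (j == i :> nat) && (v j == blank)].

Lemma is_blank_at_unary i s : (i <= N)%N ->
  is_blank_at i (scan (unary s)) = (nth 0%N s i == 0%N).
Proof.
move=> leiN; apply/existsP/idP => [[j /andP[/eqP <-]]|s0]; first by rewrite scan_unary.
by exists (inord i); rewrite scan_unary inordK // eqxx.
Qed.

Definition fseq (P Q : fragment) : fragment :=
  @Fragment (fstate P + fstate Q)%type (inl (fstart P)) (fun q v =>
    match q with
    | inl p => if fdelta p v is Some (p', a) then Some (inl p', a)
               else Some (inr (fstart Q), idle v)
    | inr p => if fdelta p v is Some (p', a) then Some (inr p', a) else None
    end).

Lemma realizes_seq P Q s1 s2 s3 :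
  realizes P s1 s2 -> realizes Q s2 s3 -> realizes (fseq P Q) s1 s3.
Proof.
move=> [p stP haltP] [q stQ haltQ]; exists (inr q); last by rewrite /= haltQ.
have st1 : @steps (fseq P Q) (inl (fstart P)) (unary s1) (inl p) (unary s2).
  by apply: (@steps_embed P (fseq P Q) inl) stP => ? ? ? ? /= ->.
apply: (steps_trans st1).
apply: steps_cons; first by rewrite /= haltP; reflexivity.
rewrite act_idle.
by apply: (@steps_embed Q (fseq P Q) inr) stQ => ? ? ? ? /= ->.
Qed.

Definition fifdec (i : nat) (P Q : fragment) : fragment :=
  @Fragment (option (fstate P + fstate Q)) None (fun q v =>
    match q with
    | None => if is_blank_at i v then Some (Some (inr (fstart Q)), idle v)
              else Some (Some (inl (fstart P)), decrement i v)
    | Some (inl p) =>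
        if fdelta p v is Some (p', a) then Some (Some (inl p'), a) else None
    | Some (inr p) =>
        if fdelta p v is Some (p', a) then Some (Some (inr p'), a) else None
    end).

Lemma realizes_ifdec i P Q s s' : (i <= N)%N ->
  (if nth 0%N s i is n.+1 then realizes P (set_nth 0%N s i n) s'
   else realizes Q s s') ->
  realizes (fifdec i P Q) s s'.
Proof.
move=> leiN; case s_i: (nth 0%N s i) => [|n] [q st halt].
  exists (Some (inr q)); last by rewrite /= halt.
  apply: steps_cons; first by rewrite /= is_blank_at_unary // s_i eqxx; reflexivity.
  rewrite act_idle.
  by apply: (@steps_embed Q (fifdec i P Q) (fun q => Some (inr q))) st => ? ? ? ? /= ->.
exists (Some (inl q)); last by rewrite /= halt.
apply: steps_cons; first by rewrite /= is_blank_at_unary // s_i; reflexivity.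
rewrite act_decrement s_i.
by apply: (@steps_embed P (fifdec i P Q) (fun q => Some (inl q))) st => ? ? ? ? /= ->.
Qed.

Definition floop (i : nat) (P : fragment) : fragment :=
  @Fragment (option (fstate P)) None (fun q v =>
    match q with
    | None => if is_blank_at i v then None
              else Some (Some (fstart P), decrement i v)
    | Some p => if fdelta p v is Some (p', a) then Some (Some p', a)
                else Some (None, idle v)
    end).

Lemma realizes_loop0 i P s : (i <= N)%N -> nth 0%N s i = 0%N ->
  realizes (floop i P) s s.
Proof.
move=> leiN s_i; exists None; first exact: steps_refl.
by rewrite /= is_blank_at_unary // s_i.
Qed.

Lemma realizes_loopS i P s s' s'' n : (i <= N)%N -> nth 0%N s i = n.+1 ->
  realizes P (set_nth 0%N s i n) s' -> realizes (floop i P) s' s'' ->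
  realizes (floop i P) s s''.
Proof.
move=> leiN s_i [p stP haltP] [q stL haltL]; exists q => //.
apply: steps_cons; first by rewrite /= is_blank_at_unary // s_i; reflexivity.
rewrite act_decrement s_i /=.
have st1 : @steps (floop i P) (Some (fstart P)) (unary (set_nth 0%N s i n))
    (Some p) (unary s').
  by apply: (@steps_embed P (floop i P) (@Some _)) stP => ? ? ? ? /= ->.
apply: (steps_trans st1).
apply: steps_cons; first by rewrite /= haltP; reflexivity.
by rewrite act_idle.
Qed.

Lemma recursive_realizes P (g : nat -> nat) :
  (forall n, realizes P [:: n] [:: g n]) -> recursive g.
Proof.
move=> Pg; exists (machine_of P) => n.
have std m : unary [:: m] = @tm_standard (machine_of P) m.
  apply/funext => i; apply/funext => z; rewrite /unary /tm_standard /=.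
  have [->|i0] /= := eqVneq i ord0; first by [].
  have -> : nth 0%N [:: m] i = 0%N.
    by case: i i0 => -[|[]] //= ? /eqP[]; apply/val_inj.
  by case: ifP => //; lia.
have [q /steps_iter[k stk] halt] := Pg n.
exists k, (q, unary [:: g n]); split => //.
- by rewrite -stk std.
- by rewrite /tm_step /= -/(scan _) halt.
- by move=> i z; rewrite -std.
Qed.

End Fragments.

(** * Calling an arbitrary machine as a subroutine *)

Section Calls.

Variables (N : nat) (G : finType) (blank stroke : G) (base : nat).
Variables (M : turing_machine) (enc : tm_symbol M -> G) (dec : G -> tm_symbol M).
Hypothesis stroke_neq_blank : stroke != blank.
Hypothesis encK : cancel enc dec.
Hypothesis enc_blank : enc (tm_blank M) = blank.
Hypothesis enc_stroke : enc (tm_stroke M) = stroke.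
Hypothesis enough_tapes : (base + tm_extra M <= N)%N.

(* Tape 0 of M becomes register i; its work tapes come after the first base   *)
(* registers.                                                                 *)
Definition callee_tape (i : nat) (j : 'I_(tm_extra M).+1) : 'I_N.+1 :=
  if j == ord0 then inord i else inord (base + j).

Lemma val_callee_tape i j : (i < base)%N ->
  callee_tape i j = (if j == ord0 then i else base + j)%N :> nat.
Proof.
move=> lti; rewrite /callee_tape; case: ifP => _; rewrite inordK //; first by lia.
by have := ltn_ord j; lia.
Qed.

Lemma callee_tape_inj i : (i < base)%N -> injective (callee_tape i).
Proof.
move=> lti j k /(congr1 val); rewrite /= !val_callee_tape //.
have [->|j0] := eqVneq j ord0; have [->|k0] := eqVneq k ord0 => // e; try lia.
by apply/val_inj => /=; lia.
Qed.

Definition fcall (i : nat) : fragment N G :=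
  @Fragment N G (tm_state M) (tm_start M) (fun q v =>
    omap (fun r => (r.1, fun x =>
        if [pick j | callee_tape i j == x] is Some j
        then (enc (r.2 j).1, (r.2 j).2) else (v x, Stay)))
      (tm_delta q [ffun j => dec (v (callee_tape i j))])).

Definition embed_tapes (i : nat) (u : 'I_N.+1 -> int -> G)
    (t : 'I_(tm_extra M).+1 -> tm_tape M) : 'I_N.+1 -> int -> G :=
  fun x => if [pick j | callee_tape i j == x] is Some j
           then fun z => enc (t j z) else u x.

Lemma pick_callee_tape i j : (i < base)%N ->
  [pick k | callee_tape i k == callee_tape i j] = Some j.
Proof.
move=> lti; case: pickP => [k /eqP/callee_tape_inj -> //|/(_ j)].
by rewrite eqxx.
Qed.

Lemma scan_embed_tapes i u t : (i < base)%N ->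
  [ffun j => dec (scan (embed_tapes i u t) (callee_tape i j))] =
  [ffun j => t j 0].
Proof.
by move=> lti; apply/ffunP => j; rewrite !ffunE /embed_tapes pick_callee_tape.
Qed.

Lemma fcall_steps i u k (c c' : tm_config M) : (i < base)%N ->
  iter k (obind (@tm_step M)) (Some c) = Some c' ->
  @steps N G (fcall i) c.1 (embed_tapes i u c.2) c'.1 (embed_tapes i u c'.2).
Proof.
move=> lti; elim: k c => [|k IH] c; first by case=> <-; exact: steps_refl.
rewrite iterSr /=; case e: (tm_step c) => [c1|]; last first.
  by have -> : iter k (obind (@tm_step M)) None = None by elim: k {IH} => //= k ->.
move=> /IH; move: e; rewrite /tm_step.
case e: tm_delta => [[q a]|] // [<-] /= st.
apply: steps_cons; first by rewrite /= scan_embed_tapes // e; reflexivity.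
set t := act_on _ _; set t' := (X in steps _ X) in st.
suff -> : t = t' by [].
apply/funext => x; apply/funext => z; rewrite /t /t' /act_on /embed_tapes ffunE /=.
case: pickP => [j _|_] /=; last by case: eqP => [->|].
by case: (a j) => y [] /=; rewrite /tm_write; case: ifP.
Qed.

(** By the output convention, [M] halts with its work tapes blank, just as they were at the start. A
    call therefore changes register [i] only, and the work tapes can serve again. *)
Lemma realizes_call g i s : (i < base)%N -> (size s <= base)%N ->
  tm_computes M g ->
  realizes blank stroke (fcall i) s (set_nth 0%N s i (g (nth 0%N s i))).
Proof.
move=> lti les /(_ (nth 0%N s i))[k [[q t] [run halt out]]].
have emb n t1 : (forall j z, t1 j z = @tm_standard M n j z) ->
    embed_tapes i (unary blank stroke s) t1 =
    unary blank stroke (set_nth 0%N s i n).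
  move=> t1E; apply/funext => x; apply/funext => z.
  rewrite /embed_tapes /unary nth_set_nth /=; case: pickP => [j /eqP <-|none].
    rewrite val_callee_tape // t1E /tm_standard.
    have [_|j0] := eqVneq j ord0; first by rewrite eqxx /=; case: ifP.
    have -> : (base + j == i)%N = false by lia.
    rewrite /= enc_blank.
    by rewrite nth_default //=; [case: ifP => //; lia|lia].
  case: eqP => // xi; have := none ord0.
  by rewrite -val_eqE /= val_callee_tape // eqxx xi eqxx.
exists q; last by
  move: halt; rewrite -(emb (g (nth 0%N s i)) t out) /= scan_embed_tapes // /tm_step /=;
  case: tm_delta => [[]|].
have := fcall_steps (unary blank stroke s) lti run.
rewrite /= (emb (g (nth 0%N s i)) t out).
rewrite (emb (nth 0%N s i) (@tm_standard M (nth 0%N s i)) (fun _ _ => erefl)).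
suff -> : unary blank stroke (set_nth 0%N s i (nth 0%N s i)) = unary blank stroke s by [].
move=> N'; apply/funext => x; apply/funext => z; rewrite /unary nth_set_nth /=.
by case: eqP => [->|].
Qed.

End Calls.

(** * Cantor pairing and its inverse as register programs *)

Definition unpair_step (p : nat * nat) : nat * nat :=
  if p.1 is m.+1 then (m, p.2.+1) else (p.2.+1, 0%N).

Definition unpair (k : nat) : nat * nat := iter k unpair_step (0%N, 0%N).

(** The codes run along the antidiagonals: after [(m.+1, n)] comes [(m, n.+1)], and after the end
    [(0, n)] of one comes the start [(n.+1, 0)] of the next. *)
Lemma cantor_pair_unpair_step p :
  cantor_pair (unpair_step p).1 (unpair_step p).2 = (cantor_pair p.1 p.2).+1.
Proof.
case: p => [[|m] n]; rewrite /cantor_pair /unpair_step /=.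
  by rewrite !addn0 add0n (binS n.+1 1) bin1; lia.
by rewrite addnS addSn addnS.
Qed.

Lemma cantor_pair_unpair k : cantor_pair (unpair k).1 (unpair k).2 = k.
Proof. by elim: k => //= k IHk; rewrite cantor_pair_unpair_step IHk. Qed.

Lemma unpairK m n : unpair (cantor_pair m n) = (m, n).
Proof.
have /cantor_pair_inj[] := cantor_pair_unpair (cantor_pair m n).
by case: unpair => /= ? ? -> ->.
Qed.

Section RegisterPrograms.

Variables (N : nat) (G : finType) (blank stroke : G).
Hypothesis stroke_neq_blank : stroke != blank.
Hypothesis registers : (4 <= N)%N.

Local Notation run := (@realizes N G blank stroke).
Local Notation inc := (@finc N G stroke).
Local Notation loop := (@floop N G blank).
Local Notation ifdec := (@fifdec N G blank).
Local Notation "P ;; Q" := (@fseq N G P Q) (at level 60, right associativity).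


(** [S] is the loop invariant, indexed by the value of the counter; the loop decrements the counter
    before it runs the body. *)
Lemma run_loop i P (S : nat -> seq nat) n s s' : (i <= N)%N ->
  (forall k, nth 0%N (S k) i = k) ->
  (forall k, (k < n)%N -> run P (set_nth 0%N (S k.+1) i k) (S k)) ->
  s = S n -> s' = S 0%N -> run (loop i P) s s'.
Proof.
move=> leiN Si step -> ->; elim: n step => [|n IH] step; first exact: realizes_loop0.
apply: (realizes_loopS _ _ (Si _) (step _ _)) => //.
by apply: IH => k ltk; apply: step; lia.
Qed.

Lemma run_inc i s s' : s' = set_nth 0%N s i (nth 0%N s i).+1 -> run (inc i) s s'.
Proof. by move=> ->; exact: realizes_inc. Qed.

Lemma run_seq P Q s1 s2 s3 : run P s1 s2 -> run Q s2 s3 -> run (P ;; Q) s1 s3.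
Proof. exact: realizes_seq. Qed.

Lemma run_unpair k :
  run (loop 0 (ifdec 1 (inc 2) (loop 2 (inc 1) ;; inc 1)))
    [:: k; 0; 0; 0]%N [:: 0; (unpair k).1; (unpair k).2; 0]%N.
Proof.
apply: (@run_loop _ _
  (fun j => [:: j; (unpair (k - j)).1; (unpair (k - j)).2; 0]%N) k) => //;
  rewrite ?subnn ?subn0 // => j ltjk.
rewrite /= (_ : unpair (k - j) = unpair_step (unpair (k - j.+1))); last first.
  by rewrite /unpair -iterS; congr iter; lia.
case: (unpair _) => -[|m] n; apply: realizes_ifdec; rewrite /unpair_step /=; try lia.
  apply: (@run_seq _ _ _ [:: j; n; 0; 0]%N); last exact: run_inc.
  apply: (@run_loop _ _ (fun i => [:: j; n - i; i; 0]%N) n) => //; try lia;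
    rewrite ?subnn ?subn0 // => i ltin.
  by apply: run_inc => /=; congr [:: _; _; _; _]; lia.
exact: run_inc.
Qed.

Lemma run_clear1 a b c d : run (loop 1 (@fskip N G)) [:: a; b; c; d] [:: a; 0; c; d]%N.
Proof.
apply: (@run_loop _ _ (fun k => [:: a; k; c; d]) b) => //; first by lia.
by move=> k _; exact: realizes_skip.
Qed.

Lemma run_clear2 a b c d : run (loop 2 (@fskip N G)) [:: a; b; c; d] [:: a; b; 0; d]%N.
Proof.
apply: (@run_loop _ _ (fun k => [:: a; b; k; d]) c) => //; first by lia.
by move=> k _; exact: realizes_skip.
Qed.

Lemma run_move10 a b c d :
  run (loop 1 (inc 0)) [:: a; b; c; d] [:: a + b; 0; c; d]%N.
Proof.
apply: (@run_loop _ _ (fun k => [:: a + (b - k); k; c; d]%N) b) => //; try lia.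
- by move=> k ltkb; apply: run_inc => /=; congr [:: _; _; _; _]; lia.
- by congr [:: _; _; _; _]; lia.
- by congr [:: _; _; _; _]; lia.
Qed.

Lemma run_move20 a b c d :
  run (loop 2 (inc 0)) [:: a; b; c; d] [:: a + c; b; 0; d]%N.
Proof.
apply: (@run_loop _ _ (fun k => [:: a + (c - k); b; k; d]%N) c) => //; try lia.
- by move=> k ltkc; apply: run_inc => /=; congr [:: _; _; _; _]; lia.
- by congr [:: _; _; _; _]; lia.
- by congr [:: _; _; _; _]; lia.
Qed.

Lemma run_pair m n :
  run (loop 2 (inc 0 ;; inc 3) ;; loop 1 (inc 3) ;;
       loop 3 (inc 0 ;; loop 3 (inc 0 ;; inc 1) ;; loop 1 (inc 3)))
    [:: 0; m; n; 0]%N [:: cantor_pair m n; 0; 0; 0]%N.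
Proof.
apply: (@run_seq _ _ _ [:: n; m; 0; n]%N).
  apply: (@run_loop _ _ (fun k => [:: n - k; m; k; n - k]%N) n) => //; try lia;
    rewrite ?subnn ?subn0 // => k ltkn.
  apply: run_seq; first exact: run_inc.
  by apply: run_inc => /=; congr [:: _; _; _; _]; lia.
apply: (@run_seq _ _ _ [:: n; 0; 0; m + n]%N).
  apply: (@run_loop _ _ (fun k => [:: n; k; 0; (m - k) + n]%N) m) => //; try lia;
    rewrite ?subnn ?subn0 // => k ltkm.
  by apply: run_inc => /=; congr [:: _; _; _; _]; lia.
(* Register 0 starts at [n] and receives [k.+1] in the round that begins with counter [k.+1], so
   ['C(k.+1, 2)] is what is still missing at counter [k]. The body empties the counter while adding
   it, and register 1 restores it. *)
apply: (@run_loop _ _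
  (fun k => [:: cantor_pair m n - 'C(k.+1, 2); 0; 0; k]%N) (m + n)) => //; try lia.
- move=> k ltk.
  have le1 : ('C(k.+2, 2) <= 'C((m + n).+1, 2))%N by rewrite leq_bin2l.
  have e2 : ('C(k.+2, 2) = 'C(k.+1, 2) + k.+1)%N by rewrite (binS k.+1 1) bin1 addnC.
  rewrite /=; set c := (_ - _)%N.
  apply: run_seq; first exact: run_inc.
  apply: (@run_seq _ _ _ [:: c + k.+1; k; 0; 0]%N); last first.
    apply: (@run_loop _ _ (fun j => [:: c + k.+1; j; 0; k - j]%N) k) => //; try lia.
    - by move=> j ltjk; apply: run_inc => /=; congr [:: _; _; _; _]; lia.
    - by congr [:: _; _; _; _]; lia.
    - by rewrite /c /cantor_pair; congr [:: _; _; _; _]; lia.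
  apply: (@run_loop _ _ (fun j => [:: c + 1 + (k - j); k - j; 0; j]%N) k) => //; try lia.
  - move=> j ltjk; apply: run_seq; first exact: run_inc.
    by apply: run_inc => /=; congr [:: _; _; _; _]; lia.
  - by rewrite /=; congr [:: _; _; _; _]; lia.
  - by rewrite /=; congr [:: _; _; _; _]; lia.
- by rewrite /cantor_pair; congr [:: _; _; _; _]; lia.
- by rewrite /= subn0.
Qed.

End RegisterPrograms.

(** * Closure properties of recursive functions *)

(* A program with subroutines for g1 and g2 runs over the product of the two  *)
(* alphabets, in which stroke and blank are the pairs of strokes and blanks.  *)
Lemma recursive_program (g1 g2 g : nat -> nat) :
  recursive g1 -> recursive g2 ->
  (forall N (G : finType) (blank stroke : G) (neq : stroke != blank)
     (call1 call2 : nat -> fragment N G), (4 <= N)%N ->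
     (forall i s, (i < 4)%N -> size s = 4%N ->
       realizes blank stroke (call1 i) s (set_nth 0%N s i (g1 (nth 0%N s i)))) ->
     (forall i s, (i < 4)%N -> size s = 4%N ->
       realizes blank stroke (call2 i) s (set_nth 0%N s i (g2 (nth 0%N s i)))) ->
     exists P : fragment N G, forall n,
       realizes blank stroke P [:: n; 0; 0; 0]%N [:: g n; 0; 0; 0]%N) ->
  recursive g.
Proof.
move=> [M1 M1g1] [M2 M2g2] prog.
pose G : finType := (tm_symbol M1 * tm_symbol M2)%type.
pose blank : G := (tm_blank M1, tm_blank M2).
pose stroke : G := (tm_stroke M1, tm_stroke M2).
have neq : stroke != blank by rewrite xpair_eqE negb_and tm_stroke_neq_blank.
pose N := (4 + (tm_extra M1 + tm_extra M2))%N.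
(* The stroke must become the common stroke; pairing every other symbol with the other machine's
   blank sends blank to blank, and the first projection still decodes. *)
pose enc1 a : G := if a == tm_stroke M1 then stroke else (a, tm_blank M2).
pose enc2 a : G := if a == tm_stroke M2 then stroke else (tm_blank M1, a).
have [|||P Pg] := prog N G blank stroke neq
    (@fcall N G 4 M1 enc1 fst) (@fcall N G 4 M2 enc2 snd).
- by rewrite /N leq_addr.
- move=> i s lti sz; apply: realizes_call => //; rewrite ?sz //.
  + by move=> a; rewrite /enc1; case: eqP => [->|].
  + by rewrite /enc1 eq_sym (negbTE (tm_stroke_neq_blank M1)).
  + by rewrite /enc1 eqxx.
  + by rewrite /N; lia.
- move=> i s lti sz; apply: realizes_call => //; rewrite ?sz //.
  + by move=> a; rewrite /enc2; case: eqP => [->|].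
  + by rewrite /enc2 eq_sym (negbTE (tm_stroke_neq_blank M2)).
  + by rewrite /enc2 eqxx.
  + by rewrite /N; lia.
apply: (recursive_realizes neq (P := P)) => n.
have unary_pad m :
    unary blank stroke [:: m] =
    unary blank stroke [:: m; 0; 0; 0]%N :> ('I_N.+1 -> _).
  by apply/funext => -[[|[|[|[|k]]]] ltk]; rewrite /unary //= nth_nil.
by rewrite /realizes !unary_pad; exact: Pg.
Qed.

Lemma recursive_id : recursive id.
Proof.
have n01 : true != false by [].
apply: (recursive_realizes n01 (P := @fskip 0 bool)) => n.
exact: realizes_skip.
Qed.

Lemma recursive_zero : recursive (fun=> 0%N).
Proof.
apply: (recursive_program recursive_id recursive_id) => N G bl st neq _ _ N4 _ _.
exists (floop bl 0 (@fskip N G)) => n.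
apply: (run_loop neq N4 (S := fun k => [:: k; 0; 0; 0]%N)) => // k _.
exact: realizes_skip.
Qed.

Lemma recursive_succ : recursive succn.
Proof.
have n01 : true != false by [].
by apply: (recursive_realizes n01 (P := @finc 0 bool true 0)) => n; exact: realizes_inc.
Qed.

Lemma recursive_comp f h : recursive f -> recursive h -> recursive (fun x => f (h x)).
Proof.
move=> rf rh; apply: (recursive_program rf rh) => N G bl st neq F H N4 callF callH.
exists (fseq (H 0%N) (F 0%N)) => n.
apply: (realizes_seq (s2 := [:: h n; 0; 0; 0]%N)); first exact: callH.
exact: callF.
Qed.

Lemma recursive_unpair1 : recursive (fun k => (unpair k).1).
Proof.
apply: (recursive_program recursive_id recursive_id) => N G bl st neq _ _ N4 _ _.
eexists => n; apply: realizes_seq; first exact: (run_unpair neq N4).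
apply: realizes_seq; first exact: (run_clear2 neq N4).
exact: (run_move10 neq N4).
Qed.

Lemma recursive_unpair2 : recursive (fun k => (unpair k).2).
Proof.
apply: (recursive_program recursive_id recursive_id) => N G bl st neq _ _ N4 _ _.
eexists => n; apply: realizes_seq; first exact: (run_unpair neq N4).
apply: realizes_seq; first exact: (run_clear1 neq N4).
exact: (run_move20 neq N4).
Qed.

Lemma recursive_pair f h : recursive f -> recursive h ->
  recursive (fun x => cantor_pair (f x) (h x)).
Proof.
move=> rf rh; apply: (recursive_program rf rh) => N G bl st neq F H N4 callF callH.
eexists => n.
apply: (realizes_seq (P := floop bl 0 (fseq (finc N st 1) (finc N st 2)))
  (s2 := [:: 0; n; n; 0]%N)).
  apply: (run_loop neq N4 (S := fun k => [:: k; n - k; n - k; 0]%N) (n := n)) => //;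
    rewrite ?subnn ?subn0 // => k ltkn.
  apply: realizes_seq; first exact: realizes_inc.
  by apply: run_inc => //=; congr [:: _; _; _; _]; lia.
apply: realizes_seq; first exact: (callF 1%N).
apply: realizes_seq; first exact: (callH 2%N).
exact: (run_pair neq N4).
Qed.

Lemma recursive_iter_pair f : recursive f ->
  recursive (fun x => iter (unpair x).1 f (unpair x).2).
Proof.
move=> rf; apply: (recursive_program rf recursive_id) => N G bl st neq F _ N4 callF _.
eexists => x; apply: realizes_seq; first exact: (run_unpair neq N4).
apply: (realizes_seq (P := floop bl 1 (F 2))
  (s2 := [:: 0; 0; iter (unpair x).1 f (unpair x).2; 0]%N)).
  case: (unpair x) => n y /=.
  apply: (run_loop neq N4 (S := fun k => [:: 0; k; iter (n - k) f y; 0]%N) (n := n)) => //;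
    rewrite ?subnn ?subn0 //; first by lia.
  move=> k ltkn; rewrite /= (_ : n - k = (n - k.+1).+1)%N; last by lia.
  exact: (callF 2%N).
exact: (run_move20 neq N4).
Qed.

Definition recursive2 (op : nat -> nat -> nat) : Prop :=
  recursive (fun p => op (unpair p).1 (unpair p).2).

(** The iterated function may depend on [x], so [x] is carried along unchanged in the first
    component of the state. *)
Lemma recursive_iter f n a : recursive2 f -> recursive n -> recursive a ->
  recursive (fun x => iter (n x) (f x) (a x)).
Proof.
move=> rf rn ra.
pose F p := cantor_pair (unpair p).1 (f (unpair p).1 (unpair p).2).
have rF : recursive F by apply: recursive_pair => //; exact: recursive_unpair1.
have := recursive_comp recursive_unpair2 (recursive_comp (recursive_iter_pair rF)
  (recursive_pair rn (recursive_pair recursive_id ra))).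
congr recursive; apply/funext => x; rewrite unpairK /=.
suff -> k : iter k F (cantor_pair x (a x)) = cantor_pair x (iter k (f x) (a x)).
  by rewrite unpairK.
by elim: k => //= k ->; rewrite /F unpairK.
Qed.

Lemma recursive_iteri f n : recursive2 f -> recursive n ->
  recursive (fun x => iteri (n x) f 0%N).
Proof.
move=> rf rn.
pose F (_ p : nat) := cantor_pair (unpair p).1.+1 (f (unpair p).1 (unpair p).2).
have rF : recursive2 F.
  apply: recursive_pair; last exact: (recursive_comp rf recursive_unpair2).
  apply: (recursive_comp recursive_succ).
  exact: (recursive_comp recursive_unpair1 recursive_unpair2).
have := recursive_comp recursive_unpair2
  (recursive_iter rF rn (recursive_pair recursive_zero recursive_zero)).
congr recursive; apply/funext => x.
suff -> k : iter k (F x) (cantor_pair 0 0) = cantor_pair k (iteri k f 0%N).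
  by rewrite unpairK.
by elim: k => //= k ->; rewrite /F unpairK.
Qed.

Lemma recursive_const c : recursive (fun=> c).
Proof.
elim: c => [|c IH]; first exact: recursive_zero.
exact: (recursive_comp recursive_succ IH).
Qed.

Lemma recursive_add f h : recursive f -> recursive h ->
  recursive (fun x => f x + h x)%N.
Proof.
move=> rf rh; have rS : recursive2 (fun _ => succn).
  exact: (recursive_comp recursive_succ recursive_unpair2).
have := recursive_iter rS rf rh; congr recursive; apply/funext => x.
by rewrite iter_succn addnC.
Qed.

Lemma recursive_mul f h : recursive f -> recursive h ->
  recursive (fun x => f x * h x)%N.
Proof.
move=> rf rh; have radd : recursive2 (fun x y => f x + y)%N.
  apply: recursive_add; last exact: recursive_unpair2.
  exact: (recursive_comp rf recursive_unpair1).
have := recursive_iter radd rh recursive_zero; congr recursive; apply/funext => x.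
by rewrite iter_addn_0.
Qed.

Lemma recursive_pred : recursive predn.
Proof.
have := @recursive_iteri (fun i _ => i) id recursive_unpair1 recursive_id.
by congr recursive; apply/funext => -[].
Qed.

Lemma recursive_sub f h : recursive f -> recursive h ->
  recursive (fun x => f x - h x)%N.
Proof.
move=> rf rh; have rP : recursive2 (fun _ => predn).
  exact: (recursive_comp recursive_pred recursive_unpair2).
have := recursive_iter rP rh rf; congr recursive; apply/funext => x.
by rewrite iter_predn.
Qed.

Lemma recursive_half : recursive half.
Proof.
(* The map from [(u, v)] to [(v, u + 1)] turns the floor and ceiling of [k / 2] into those of
   [(k + 1) / 2]. *)
pose F (_ p : nat) := cantor_pair (unpair p).2 (unpair p).1.+1.
have rF : recursive2 F.
  apply: recursive_pair.
    exact: (recursive_comp recursive_unpair2 recursive_unpair2).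
  apply: (recursive_comp recursive_succ).
  exact: (recursive_comp recursive_unpair1 recursive_unpair2).
have := recursive_comp recursive_unpair1
  (recursive_iter rF recursive_id (recursive_pair recursive_zero recursive_zero)).
congr recursive; apply/funext => x.
suff -> k : iter k (F x) (cantor_pair 0 0) = cantor_pair k./2 (uphalf k).
  by rewrite unpairK.
by elim: k => //= k ->; rewrite /F unpairK.
Qed.

Lemma recursive_leq f h : recursive f -> recursive h ->
  recursive (fun x => (f x <= h x)%N : nat).
Proof.
move=> rf rh.
have := recursive_sub (recursive_const 1) (recursive_sub rf rh).
by congr recursive; apply/funext => x /=; lia.
Qed.

Lemma recursive_if (c : nat -> bool) f h :
  recursive (fun x => c x : nat) -> recursive f -> recursive h ->
  recursive (fun x => if c x then f x else h x).
Proof.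
move=> rc rf rh; have := recursive_add (recursive_mul rc rf)
  (recursive_mul (recursive_sub (recursive_const 1) rc) rh).
by congr recursive; apply/funext => x; case: (c x) => /=; lia.
Qed.

Lemma recursive_odd : recursive (fun x => odd x : nat).
Proof.
have := recursive_sub recursive_id (recursive_add recursive_half recursive_half).
by congr recursive; apply/funext => x /=; lia.
Qed.

Lemma recursive_expn2 : recursive (expn 2).
Proof.
have rF : recursive2 (fun _ y => y + y)%N.
  by apply: recursive_add; exact: recursive_unpair2.
have := recursive_iter rF recursive_id (recursive_const 1).
congr recursive; apply/funext => x; elim: x => //= x ->.
by rewrite expnS mul2n addnn.
Qed.

Definition path_product (f : nat -> nat) (s : situation) : nat :=
  \prod_(i < size s) f (code_situation (take i.+1 s)).

Lemma path_product_rcons f s x :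
  path_product f (rcons s x) = (path_product f s * f (code_situation (rcons s x)))%N.
Proof.
rewrite /path_product size_rcons big_ord_recr /=; congr (_ * f (code_situation _))%N.
  apply: eq_bigr => i _; rewrite -cats1 takel_cat //.
by rewrite take_oversize // size_rcons.
Qed.

Lemma path_product_gt0 f s : (forall k, 0 < f k)%N -> (0 < path_product f s)%N.
Proof. by move=> f0; rewrite prodn_gt0. Qed.

(** The parent of code [k > 0] is [k.-1./2], so the product is accumulated by climbing to the root.
    Running [code_situation s] rounds is enough, and the extra rounds at the root change nothing. *)
Lemma recursive_path_product f : recursive f ->
  exists2 g, recursive g & forall s, path_product f s = g (code_situation s).
Proof.
move=> rf.
pose F (_ p : nat) := cantor_pair (unpair p).1.-1./2
  (if (unpair p).1 <= 0 then (unpair p).2 else (unpair p).2 * f (unpair p).1)%N.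
have r1 := recursive_comp recursive_unpair1 recursive_unpair2.
have r2 := recursive_comp recursive_unpair2 recursive_unpair2.
have rF : recursive2 F.
  apply: recursive_pair.
    exact: (recursive_comp recursive_half (recursive_comp recursive_pred r1)).
  apply: recursive_if; [exact: recursive_leq r1 recursive_zero | exact: r2 |].
  by apply: recursive_mul => //; exact: (recursive_comp rf r1).
exists (fun k => (unpair (iter k (F k) (cantor_pair k 1))).2).
  apply: (recursive_comp recursive_unpair2).
  exact: (recursive_iter rF recursive_id (recursive_pair recursive_id (recursive_const 1))).
move=> s; set c := (X in iter _ (F X)).
suff main : forall n acc, (code_situation s <= n)%N ->
    iter n (F c) (cantor_pair (code_situation s) acc) =
    cantor_pair 0 (acc * path_product f s).
  by rewrite main // unpairK mul1n.
move: c => c; elim/last_ind: s => [|s x IHs] n acc.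
  move=> _; rewrite /path_product big_ord0 muln1.
  by elim: n => //= n ->; rewrite /F unpairK.
rewrite path_product_rcons code_situation_rcons.
case: n => [|n] len; first by lia.
rewrite iterSr {2}/F unpairK /= ifN; last by lia.
rewrite addn1 /= (_ : ((code_situation s).*2 + x)./2 = code_situation s);
  last by case: x len => /=; lia.
rewrite IHs; last by lia.
by rewrite mulnAC mulnA.
Qed.

(** * Test supermartingales of product form *)

Section Processes.

Variable R : realType.

Implicit Types (I J : interval_forecast R) (omega : binary_path).

Definition nat_ratio (num den : nat -> nat) (k : nat) : R := (num k)%:R / (den k)%:R.

Definition product_process (num den : nat -> nat) : real_process R :=
  fun s => (path_product num s)%:R / (path_product den s)%:R.

Lemma product_process_nil num den : product_process num den [::] = 1.
Proof. by rewrite /product_process /path_product !big_ord0 divr1. Qed.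

Lemma product_process_rcons num den s x :
  product_process num den (rcons s x) =
  product_process num den s * nat_ratio num den (code_situation (rcons s x)).
Proof.
by rewrite /product_process /nat_ratio !path_product_rcons !natrM mulf_div.
Qed.

Lemma product_process_ge0 num den s : 0 <= product_process num den s.
Proof. by rewrite divr_ge0. Qed.

Lemma recursive_SN_situation f g : recursive g ->
  (forall s, f s = g (code_situation s)) -> recursive_SN (fun s _ => f s).
Proof.
move=> rg fg; exists (fun k => g (unpair k).1).
  exact: recursive_comp rg recursive_unpair1.
by move=> s n; rewrite unpairK.
Qed.

Lemma computable_product_process num den : recursive num -> recursive den ->
  (forall k, 0 < den k)%N -> computable_process (product_process num den).
Proof.
move=> rn rd d0.
have [gn rgn pn] := recursive_path_product rn.
have [gd rgd pd] := recursive_path_product rd.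
exists (fun s _ => (path_product num s)%:R / (path_product den s)%:R), (fun _ _ => 0%N).
split.
- exists (fun s _ => path_product num s), (fun s _ => path_product den s), (fun _ _ => 0%N).
  split.
  + exact: recursive_SN_situation rgn pn.
  + exact: recursive_SN_situation rgd pd.
  + exact: (recursive_SN_situation recursive_zero).
  + by move=> s _; exact: path_product_gt0.
  + by move=> s n; rewrite expr0 mul1r.
- exact: (recursive_SN_situation recursive_zero).
- move=> s N n _; rewrite fmorph_div !rmorph_nat subrr normr0.
  by rewrite invr_ge0 exprn_ge0.
Qed.

Lemma upper_expectation_le0 I f :
  (forall p, (I : set R) p -> local_expectation p f <= 0) -> upper_expectation I f <= 0.
Proof. by have [[p Ip ->] _] := upper_expectation_max I f; apply. Qed.

Lemma supermartingale_product_process I num den :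
  (forall s p, (I : set R) p ->
     local_expectation p (fun x => nat_ratio num den (code_situation (rcons s x))) <= 1) ->
  test_supermartingale (stationary I) (product_process num den).
Proof.
move=> le1; split.
  by split; [exact: product_process_ge0 | exact: product_process_nil].
move=> s; apply: upper_expectation_le0 => p Ip.
have := le1 s p Ip; have := product_process_ge0 num den s.
rewrite /local_expectation /process_difference !product_process_rcons.
set F := product_process _ _ _; set u := nat_ratio _ _ _; set v := nat_ratio _ _ _.
by nra.
Qed.

Lemma limn_esup_le0_lt1 (u : nat -> R) : (limn_esup (fun n => (u n)%:E) <= 0)%E ->
  exists n0, forall n, (n0 <= n)%N -> u n < 1.
Proof.
rewrite /limn_esup /limf_esup => le0.
have /ereal_inf_lt[_ [V [n0 _ Vn0] <-] lt1] := le_lt_trans le0 (@lte01 R).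
exists n0 => n len; rewrite -lte_fin; apply: le_lt_trans lt1.
by apply: ereal_sup_ubound; exists n => //; apply: Vn0.
Qed.

Lemma limn_esup_le0 (u : nat -> R) n0 : (forall n, (n0 <= n)%N -> u n <= 0) ->
  (limn_esup (fun n => (u n)%:E) <= 0)%E.
Proof.
move=> le0; rewrite /limn_esup /limf_esup.
apply: (@le_trans _ _ (ereal_sup ((fun n => (u n)%:E) @` [set n | (n0 <= n)%N]))).
  apply: ereal_inf_lbound; exists [set n | (n0 <= n)%N] => //.
  by exists n0.
by apply: ge_ereal_sup => _ [n /= len <-]; rewrite lee_fin; exact: le0.
Qed.

(* For 0 < C <= y, the largest v with C * (v + 1) ^ 2 <= y.                   *)
Definition slow_root (C y : nat) : nat :=
  iteri y (fun i v => if (C * (v.+2 * v.+2) <= i.+1)%N then v.+1 else v) 0.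

Lemma recursive_slow_root C : recursive (slow_root C).
Proof.
apply: (recursive_iteri _ recursive_id).
have r1 := recursive_unpair1; have r2 := recursive_unpair2.
have rS2 := recursive_comp recursive_succ (recursive_comp recursive_succ r2).
apply: recursive_if => //; last exact: recursive_comp recursive_succ r2.
apply: recursive_leq; last exact: recursive_comp recursive_succ r1.
exact: recursive_mul (recursive_const C) (recursive_mul rS2 rS2).
Qed.

Lemma slow_rootS C y : slow_root C y.+1 =
  if (C * ((slow_root C y).+2 * (slow_root C y).+2) <= y.+1)%N
  then (slow_root C y).+1 else slow_root C y.
Proof. by []. Qed.

Lemma slow_root_le C y : (C <= y)%N ->
  (C * ((slow_root C y).+1 * (slow_root C y).+1) <= y)%N.
Proof.
elim: y => [|y IH]; first by case: C.
rewrite slow_rootS; case: ifP => // _.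
rewrite leq_eqVlt => /predU1P[eC|/IH]; last by lia.
(* The first increment requires an argument of at least [4 * C], so the value is still 0 just before
   [C]. *)
suff /(_ y (leqnn y)) -> : forall z, (z <= y)%N -> slow_root C z = 0%N by lia.
by elim=> // z IHz ltzy; rewrite slow_rootS IHz ?ifN //; lia.
Qed.

Lemma slow_root_homo C m n : (m <= n)%N -> (slow_root C m <= slow_root C n)%N.
Proof.
elim: n => [|n IH]; first by case: m.
rewrite leq_eqVlt => /predU1P[-> //|/IH /leq_trans]; apply.
by rewrite slow_rootS; case: ifP.
Qed.

Lemma slow_root_unbounded C B : exists y, (B < slow_root C y)%N.
Proof.
have reach v : exists y, (v <= slow_root C y)%N.
  elim: v => [|v [y IH]]; first by exists 0%N.
  pose z := (y + C * (v.+2 * v.+2))%N.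
  have : (v <= slow_root C z)%N.
    by apply: leq_trans IH _; apply: slow_root_homo; rewrite leq_addr.
  rewrite leq_eqVlt => /predU1P[vz|]; last by exists z.
  by exists z.+1; rewrite slow_rootS -vz ifT // /z; lia.
exact: reach.
Qed.

(** With [sigma = slow_root C rho], randomness eventually gives [U < sigma + 1] and [V < sigma + 1],
    and [C * (sigma + 1) ^ 2 <= rho] once [rho] has reached [C]. *)
Lemma schnorr_product_lt omega I J U V rho (C : nat) :
  schnorr_random (stationary I) omega -> schnorr_random (stationary J) omega ->
  computable_process U -> test_supermartingale (stationary I) U ->
  computable_process V -> test_supermartingale (stationary J) V ->
  growth_function rho ->
  exists n0, forall n, (n0 <= n)%N ->
    C%:R * (U (mkseq omega n) * V (mkseq omega n)) <= (rho n)%:R.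
Proof.
move=> randI randJ cU tU cV tV [rrho mono unb].
pose sigma n := slow_root C (rho n).
have gsigma : growth_function sigma.
  split.
  - exact: recursive_comp (recursive_slow_root C) rrho.
  - by move=> m n /mono; exact: slow_root_homo.
  - move=> B; have [y By] := slow_root_unbounded C B; have [n yn] := unb y.
    by exists n; apply: leq_trans By _; apply: slow_root_homo; exact: ltnW.
have [nU ltU] := limn_esup_le0_lt1 (randI _ _ cU tU gsigma).
have [nV ltV] := limn_esup_le0_lt1 (randJ _ _ cV tV gsigma).
have [nC ltC] := unb C.
exists (nU + nV + nC)%N => n len.
have {}ltU := ltU n (leq_trans _ len); have {}ltV := ltV n (leq_trans _ len).
have U0 := tU.1.1 (mkseq omega n); have V0 := tV.1.1 (mkseq omega n).
have Cn : (C <= rho n)%N by apply: leq_trans (ltnW ltC) (mono _ _ _); lia.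
have := slow_root_le Cn; rewrite -/(sigma n) -(ler_nat R) !natrM.
apply: le_trans; apply: ler_wpM2l => //; apply: ler_pM => //.
  by apply: ltW; have := ltU _; rewrite -natr1 ltrBlDl addrC; apply; lia.
by apply: ltW; have := ltV _; rewrite -natr1 ltrBlDl addrC; apply; lia.
Qed.

End Processes.

(** * Disjoint intervals and crossing intervals *)

Section Intersections.

Variable R : realType.

Implicit Types (I J K : interval_forecast R) (omega : binary_path).

Lemma schnorr_not_disjoint omega I J (b c : R) : b < c -> 0 <= b -> c <= 1 ->
  (forall p, (I : set R) p -> p <= b) -> (forall p, (J : set R) p -> c <= p) ->
  schnorr_random (stationary I) omega -> schnorr_random (stationary J) omega ->
  False.
Proof.
move=> ltbc b0 c1 Ib Jc randI randJ.
(* A gap longer than 2 between [b * D] and [c * D] leaves room for two consecutive integers, giving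
   [p1 = m.+1 / D] and [p2 = m.+2 / D]. *)
have [D ltD] : exists D : nat, 2 < (c - b) * D%:R.
  exists (Num.bound (2 / (c - b))); rewrite mulrC -ltr_pdivrMr ?subr_gt0 //.
  by apply: le_lt_trans (archi_boundP _); rewrite ?ler_norm // divr_ge0 //; lra.
have [m lem ltm] : exists2 m : nat, m%:R <= b * D%:R & b * D%:R < m.+1%:R.
  by exists (Num.truncn (b * D%:R));
    have /andP[] := @truncn_itv R (b * D%:R) (mulr_ge0 b0 (ler0n _ _)).
have ltmc : m.+2%:R < c * D%:R.
  by move: ltD lem; rewrite -!natr1; lra.
have ltmD : (m.+2 < D)%N.
  by rewrite -(ltr_nat R); apply: lt_le_trans ltmc _; rewrite ler_piMl.
(* With stake [xi = 1 / (2 * D)], the denominator [w] makes both betting factors fractions of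
   naturals. An odd code means that the last outcome is 0. *)
have [w wE] : exists w, w = (2 * (D * D))%N by eexists.
pose numU k := (if odd k then w - m.+1 else w + D - m.+1)%N.
pose numV k := (if odd k then w + m.+2 else w - D + m.+2)%N.
pose den (_ : nat) := w.
have rU : recursive numU by apply: recursive_if recursive_odd _ _; exact: recursive_const.
have rV : recursive numV by apply: recursive_if recursive_odd _ _; exact: recursive_const.
have rden : recursive den by exact: recursive_const.
have DD : (D <= D * D)%N by nia.
have den0 k : (0 < den k)%N by rewrite /den; lia.
have wR : w%:R = 2 * (D%:R * D%:R) :> R by rewrite wE !natrM.
have oddE s x : odd (code_situation (rcons s x)) = ~~ x.
  by rewrite code_situation_rcons; lia.
have D0 : 0 < D%:R :> R by rewrite ltr0n; lia.
have ratioU s x : nat_ratio R numU den (code_situation (rcons s x)) =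
    1 + (x%:R * D%:R - m.+1%:R) / (2 * (D%:R * D%:R)).
  rewrite /nat_ratio /numU /den oddE; case: x => /=; rewrite natrB ?natrD ?wR; try lia.
    by field; rewrite gt_eqF.
  by field; rewrite gt_eqF.
have ratioV s x : nat_ratio R numV den (code_situation (rcons s x)) =
    1 - (x%:R * D%:R - m.+2%:R) / (2 * (D%:R * D%:R)).
  rewrite /nat_ratio /numV /den oddE; case: x => /=; rewrite natrD ?natrB ?wR; try lia.
    by field; rewrite gt_eqF.
  by field; rewrite gt_eqF.
have DD0 : 0 < (2 * (D%:R * D%:R))^-1 :> R by rewrite invr_gt0 !mulr_gt0.
have tU : test_supermartingale (stationary I) (product_process R numU den).
  apply: supermartingale_product_process => s p /Ib lepb.
  rewrite /local_expectation !ratioU /=.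
  have : p * D%:R <= b * D%:R by rewrite ler_pM2r.
  by move: DD0; set z := _^-1 => DD0 ?; nra.
have tV : test_supermartingale (stationary J) (product_process R numV den).
  apply: supermartingale_product_process => s p /Jc lecp.
  rewrite /local_expectation !ratioV /=.
  have : c * D%:R <= p * D%:R by rewrite ler_pM2r.
  by move: DD0; set z := _^-1 => DD0 ?; nra.
have id_growth : growth_function id.
  by split=> // [|B]; [exact: recursive_id | exists B.+1].
(* The product grows at least by the factor [1 + 1 / C] per outcome, where [C = 4 * (D * D)]. So
   [C * (U * V)] gains at least 1 each time and is at least [C + n], which contradicts the bound for
   [rho = id]. *)
have [n0 /(_ n0 (leqnn _))] := schnorr_product_lt (4 * (D * D))%N randI randJ
  (computable_product_process R rU rden den0) tU
  (computable_product_process R rV rden den0) tV id_growth.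
have C0 : 0 < (4 * (D * D))%N%:R :> R by rewrite ltr0n; lia.
set P := _ * _; suff : (4 * (D * D) + n0)%N%:R <= P by rewrite natrD; lra.
suff lower s : (4 * (D * D) + size s)%N%:R <= (4 * (D * D))%N%:R *
    (product_process R numU den s * product_process R numV den s).
  by have := lower (mkseq omega n0); rewrite size_mkseq.
elim/last_ind: s => [|s x IHs].
  by rewrite !product_process_nil !mulr1 addn0.
rewrite !product_process_rcons ratioU ratioV size_rcons.
set u := product_process _ _ _ s in IHs *; set v := product_process _ _ _ s in IHs *.
(* Since [p2 - p1 = 2 * xi], the product is [1 + 2 * xi ^ 2 - xi ^ 2 * (x - p1) * (x - p2)], and the
   last term costs at most [xi ^ 2]. *)
have step : 1 + (4 * (D%:R * D%:R))^-1 <=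
    (1 + (x%:R * D%:R - m.+1%:R) / (2 * (D%:R * D%:R))) *
    (1 - (x%:R * D%:R - m.+2%:R) / (2 * (D%:R * D%:R))) :> R.
  rewrite -subr_ge0; set e := (X in 0 <= X).
  have -> : e = (D%:R * D%:R + (x%:R * D%:R - m.+1%:R) - (x%:R * D%:R - m.+1%:R) ^+ 2)
      / (4 * (D%:R * D%:R) * (D%:R * D%:R)).
    by rewrite /e -[m.+2%:R]natr1; field; rewrite gt_eqF.
  apply: divr_ge0; last by rewrite !mulr_ge0.
  have : m.+1%:R + 1 <= D%:R :> R by rewrite natr1 ler_nat ltnW.
  have : 0 <= m.+1%:R :> R by [].
  by case: (x) => /=; rewrite ?mul1r ?mul0r; nra.
set f := (X in _ <= X) in step; rewrite mulrACA -/f mulrA.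
have uv0 : 0 <= (4 * (D * D))%N%:R * (u * v) by rewrite !mulr_ge0 ?product_process_ge0.
apply: le_trans (ler_wpM2l uv0 step).
have : (4 * (D * D))%N%:R <= (4 * (D * D))%N%:R * (u * v).
  by apply: le_trans IHs; rewrite ler_nat leq_addr.
rewrite mulrDr mulr1 => le4.
have : 1 <= (4 * (D * D))%N%:R * (u * v) / (4 * (D%:R * D%:R)).
  by rewrite -!natrM ler_pdivlMr ?mul1r.
by rewrite addnS -natr1; lra.
Qed.

(** Add [2 ^- k] to an approximation of [T] with error at most [2 ^- k.+2], where [k] is the code of
    the situation. Codes increase along paths, so this surplus at least halves at each step, which
    absorbs both errors and keeps the increments below those of [T]. *)
Lemma rational_majorant (T : real_process R) : computable_process T ->
  (forall s, 0 <= T s) ->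
  exists num den, [/\ recursive num, recursive den,
    forall s, (0 < num (code_situation s))%N /\ (0 < den (code_situation s))%N,
    forall s, T s <= nat_ratio R num den (code_situation s) &
    forall s x, nat_ratio R num den (code_situation (rcons s x)) -
      nat_ratio R num den (code_situation s) <= T (rcons s x) - T s].
Proof.
move=> [r [e [[a [b [sg [[ga rga aE] [gb rgb bE] [gs rgs sE] b0 rE]]]] [ge rge eE] approx]]] T0.
pose N k := ge (cantor_pair k k.+2).
have rN : recursive N.
  apply: (recursive_comp rge); apply: recursive_pair recursive_id _.
  exact: recursive_comp recursive_succ recursive_succ.
have rcode : recursive (fun k => cantor_pair k (N k)) by exact: recursive_pair recursive_id rN.
pose A k := ga (cantor_pair k (N k)); pose B k := gb (cantor_pair k (N k)).
pose S k := gs (cantor_pair k (N k)).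
have rA : recursive A by exact: recursive_comp rga rcode.
have rB : recursive B by exact: recursive_comp rgb rcode.
have rS : recursive S by exact: recursive_comp rgs rcode.
have rA2 := recursive_mul rA recursive_expn2.
pose num k := (if odd (S k) then B k - A k * 2 ^ k else B k + A k * 2 ^ k)%N.
pose den k := (B k * 2 ^ k)%N.
pose q s := ratr (r s (N (code_situation s))) : R.
have qT s : `|q s - T s| <= 2 ^- (code_situation s).+2 by apply: approx; rewrite eE.
have B0 s : (0 < B (code_situation s))%N by rewrite /B -bE.
have qE s : q s = (-1) ^+ S (code_situation s) *
    ((A (code_situation s))%:R / (B (code_situation s))%:R).
  by rewrite /q rE rmorphM rmorphXn rmorphN1 fmorph_div !rmorph_nat aE bE sE.
have pow0 k : 0 < 2 ^- k :> R by rewrite invr_gt0 exprn_gt0.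
have powS k : 2 ^- k.+1 = 2 ^- k / 2 :> R by rewrite exprS invfM mulrC.
(* A negative approximation of the non-negative [T] is at least [- 2 ^- k.+2], so the truncated
   subtraction in [num] is a true one with a positive result. *)
have small s : odd (S (code_situation s)) ->
    (A (code_situation s) * 2 ^ code_situation s < B (code_situation s))%N.
  move=> oS; have := T0 s; have := qT s; rewrite qE -signr_odd oS expr1 !powS.
  move: (B0 s) (pow0 (code_situation s)).
  set k := code_situation s => Bk pk; rewrite ler_norml => /andP[le1 _] le2.
  rewrite -(ltr_nat R) natrM natrX.
  rewrite -ltr_pdivlMr ?exprn_gt0 // mulrC -ltr_pdivrMr ?ltr0n //.
  by move: le1; rewrite mulN1r; move: pk le2; set z := 2 ^- k; lra.
have ratioE s : nat_ratio R num den (code_situation s) = q s + 2 ^- code_situation s.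
  rewrite qE /nat_ratio /num /den; have := small s; have := B0 s.
  set k := code_situation s => Bk; rewrite -signr_odd; case: odd => [/(_ isT) lt|_].
    rewrite natrB ?(ltnW lt) // !natrM !natrX expr1.
    by field; rewrite expf_neq0 ?pnatr_eq0 //= -lt0n.
  rewrite natrD !natrM !natrX expr0.
  by field; rewrite expf_neq0 ?pnatr_eq0 //= -lt0n.
exists num, den; split.
- apply: recursive_if; first exact: recursive_comp recursive_odd rS.
    exact: recursive_sub.
  exact: recursive_add.
- exact: recursive_mul rB recursive_expn2.
- move=> s; split; last by rewrite muln_gt0 B0 expn_gt0.
  rewrite /num; case: ifP => [/small|_]; first by rewrite subn_gt0.
  by rewrite addn_gt0 B0.
- move=> s; rewrite ratioE; have := qT s; have := pow0 (code_situation s).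
  by rewrite !powS ler_norml => ? /andP[]; lra.
- move=> s x; rewrite !ratioE; have := qT s; have := qT (rcons s x).
  have : 2 ^- code_situation (rcons s x) <= 2 ^- code_situation s / 2 :> R.
    rewrite -powS lef_pV2 ?posrE ?exprn_gt0 // ler_eXn2l ?ltr1n //.
    by rewrite code_situation_rcons; lia.
  have := pow0 (code_situation s).
  have := pow0 (code_situation (rcons s x)).
  rewrite !powS !ler_norml => ? ? ? /andP[? ?] /andP[? ?]; lra.
Qed.

Lemma schnorr_overlapping omega I J K (b c : R) :
  (forall p, (I : set R) p -> p <= b) -> (forall p, (J : set R) p -> c <= p) ->
  (K : set R) b -> (K : set R) c ->
  schnorr_random (stationary I) omega -> schnorr_random (stationary J) omega ->
  schnorr_random (stationary K) omega.
Proof.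
move=> Ib Jc Kb Kc randI randJ T rho cT [[T0 _] superT] grho.
have [num [den [rnum rden pos leT dT]]] := rational_majorant cT T0.
pose q := nat_ratio R num den.
have {}pos k : (0 < num k)%N /\ (0 < den k)%N.
  by have [s <-] := code_situation_surj k; exact: pos.
have q0 k : 0 < q k by rewrite divr_gt0 ?ltr0n //; have [] := pos k.
(* The successors of the situation coded by [k] have codes [2 * k + 1] (outcome 0) and [2 * k + 2]
   (outcome 1); cross-multiplication makes the comparison of their values recursive. *)
pose up k := (num k.*2.+1 * den k.*2.+2 <= num k.*2.+2 * den k.*2.+1)%N.
pose parent k := k.-1./2.
have parent_rcons s x : parent (code_situation (rcons s x)) = code_situation s.
  by rewrite /parent code_situation_rcons; case: x; lia.
have upE s : up (code_situation s) =
    (q (code_situation (rcons s false)) <= q (code_situation (rcons s true))).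
  rewrite !code_situation_rcons /= addn0 !addn1 /q /nat_ratio.
  set k1 := _.+1; set k2 := _.+2.
  rewrite ler_pdivrMr ?ltr0n; last by have [] := pos k1.
  rewrite mulrAC ler_pdivlMr ?ltr0n; last by have [] := pos k2.
  by rewrite -!natrM ler_nat.
have rpar : recursive parent by exact: recursive_comp recursive_half recursive_pred.
have rup : recursive (fun k => up (parent k) : nat).
  have r1 : recursive (fun k => k.*2.+1).
    apply: (recursive_comp recursive_succ).
    have := recursive_add recursive_id recursive_id.
    by congr recursive; apply/funext => k; rewrite addnn.
  have r2 : recursive (fun k => k.*2.+2) by exact: recursive_comp recursive_succ r1.
  apply: (recursive_comp (f := fun k => up k : nat)) rpar.
  by apply: recursive_leq; apply: recursive_mul; exact: recursive_comp.
pose stepnum k := (num k * den (parent k))%N.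
pose stepden k := (den k * num (parent k))%N.
have rsn : recursive stepnum by exact: recursive_mul rnum (recursive_comp rden rpar).
have rsd : recursive stepden by exact: recursive_mul rden (recursive_comp rnum rpar).
have r1 := recursive_const 1.
pose numU k := if up (parent k) then stepnum k else 1%N.
pose denU k := if up (parent k) then stepden k else 1%N.
pose numV k := if up (parent k) then 1%N else stepnum k.
pose denV k := if up (parent k) then 1%N else stepden k.
have sd0 k : (0 < stepden k)%N.
  by have [? ?] := pos k; have [? ?] := pos (parent k); rewrite muln_gt0; apply/andP.
have denU0 k : (0 < denU k)%N by rewrite /denU; case: ifP.
have denV0 k : (0 < denV k)%N by rewrite /denV; case: ifP.
have stepE s x : nat_ratio R stepnum stepden (code_situation (rcons s x)) =
    q (code_situation (rcons s x)) / q (code_situation s).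
  by rewrite /q /nat_ratio /stepnum /stepden parent_rcons !natrM invf_div mulf_div.
have ratioU s x : nat_ratio R numU denU (code_situation (rcons s x)) =
    if up (code_situation s) then q (code_situation (rcons s x)) / q (code_situation s) else 1.
  rewrite -stepE /nat_ratio /numU /denU parent_rcons; case: ifP => // _.
  by rewrite divr1.
have ratioV s x : nat_ratio R numV denV (code_situation (rcons s x)) =
    if up (code_situation s) then 1 else q (code_situation (rcons s x)) / q (code_situation s).
  rewrite -stepE /nat_ratio /numV /denV parent_rcons; case: ifP => // _.
  by rewrite divr1.
have superq s p : (K : set R) p ->
    p * q (code_situation (rcons s true)) + (1 - p) * q (code_situation (rcons s false))
      <= q (code_situation s).
  move=> Kp; have := le_trans ((upper_expectation_max K _).2 p Kp) (superT s).
  have Kp01 : 0 <= p <= 1.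
    case: K Kp {superT Kb Kc} => _ /= [x [y [? ? ? ->]]].
    by rewrite /= in_itv /= => /andP[? ?]; apply/andP; split; lra.
  have := dT s true; have := dT s false; rewrite -/q /local_expectation /process_difference.
  by nra.
have tU : test_supermartingale (stationary I) (product_process R numU denU).
  apply: supermartingale_product_process => s p /Ib lepb.
  rewrite /local_expectation !ratioU upE; case: (leP (q _) (q _)) => [le|_]; last by lra.
  rewrite (mulrA p) (mulrA (1 - p)) -mulrDl ler_pdivrMr // mul1r.
  (* On an upward step the mean is non-decreasing in [p], so its value at [b] bounds it on all of
     [I]. *)
  apply: le_trans (superq s b Kb).
  by have : 0 <= (b - p) * (q (code_situation (rcons s true)) -
    q (code_situation (rcons s false))); [rewrite mulr_ge0 ?subr_ge0|lra].
have tV : test_supermartingale (stationary J) (product_process R numV denV).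
  apply: supermartingale_product_process => s p /Jc lecp.
  rewrite /local_expectation !ratioV upE; case: (leP (q _) (q _)) => lt; first by lra.
  rewrite (mulrA p) (mulrA (1 - p)) -mulrDl ler_pdivrMr // mul1r.
  apply: le_trans (superq s c Kc).
  by have : 0 <= (p - c) * (q (code_situation (rcons s false)) -
    q (code_situation (rcons s true))); [rewrite mulr_ge0 ?subr_ge0 // ltW|lra].
have prodE s : product_process R numU denU s * product_process R numV denV s =
    q (code_situation s) / q 0%N.
  elim/last_ind: s => [|s x IHs].
    by rewrite !product_process_nil mulr1 divff // gt_eqF.
  rewrite !product_process_rcons mulrACA IHs ratioU ratioV.
  by case: ifP => _; field; rewrite !gt_eqF.
(* The product of the two processes telescopes to [q / q 0]; as [num 0] is a natural number above or
   equal to [q 0], it scales this back to at least [q], hence at least [T]. *)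
have [n0 bound] := schnorr_product_lt (num 0%N) randI randJ
  (computable_product_process R (recursive_if rup rsn r1) (recursive_if rup rsd r1) denU0) tU
  (computable_product_process R (recursive_if rup r1 rsn) (recursive_if rup r1 rsd) denV0) tV grho.
apply: (@limn_esup_le0 _ _ n0) => n len.
rewrite subr_le0; apply: le_trans (leT _) (le_trans _ (bound n len)).
rewrite prodE -/q mulrCA ler_peMr ?(ltW (q0 _)) //.
rewrite ler_pdivlMr // mul1r /q /nat_ratio ler_pdivrMr ?ltr0n; last by have [] := pos 0%N.
by rewrite ler_peMr // ler1n; have [] := pos 0%N.
Qed.

End Intersections.

Theorem proposition33 (R : realType) (omega : binary_path)
    (I J : interval_forecast R) :
  schnorr_forecasts omega I -> schnorr_forecasts omega J ->
  (I : set R) `&` (J : set R) !=set0 /\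
  exists2 K : interval_forecast R,
    (K : set R) = (I : set R) `&` (J : set R) & schnorr_forecasts omega K.
Proof.
rewrite /schnorr_forecasts /= => randI randJ.
have [a [b [a0 ab b1 IE]]] : exists a b : R,
    [/\ 0 <= a, a <= b, b <= 1 & (I : set R) = `[a, b]%classic] by case: (I).
have [c [d [c0 cd d1 JE]]] : exists c d : R,
    [/\ 0 <= c, c <= d, d <= 1 & (J : set R) = `[c, d]%classic] by case: (J).
have inI p : (I : set R) p = (a <= p <= b) by rewrite IE /= in_itv.
have inJ p : (J : set R) p = (c <= p <= d) by rewrite JE /= in_itv.
have lecb : c <= b.
  rewrite leNgt; apply/negP => ltbc.
  apply: (schnorr_not_disjoint ltbc _ _ _ _ randI randJ); try lra.
    by move=> p; rewrite inI => /andP[].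
  by move=> p; rewrite inJ => /andP[].
have lead : a <= d.
  rewrite leNgt; apply/negP => ltda.
  apply: (schnorr_not_disjoint ltda _ _ _ _ randJ randI); try lra.
    by move=> p; rewrite inJ => /andP[].
  by move=> p; rewrite inI => /andP[].
have KE : (I : set R) `&` (J : set R) = `[Num.max a c, Num.min b d]%classic.
  apply/seteqP; split => p /=; rewrite IE JE /= !in_itv /= ge_max le_min.
    by move=> [/andP[-> ->] /andP[-> ->]].
  by move=> /andP[/andP[-> ->] /andP[-> ->]].
have le_max_min : Num.max a c <= Num.min b d.
  by rewrite ge_max !le_min ab lead lecb cd.
split; first by exists (Num.max a c); rewrite KE /= in_itv /= lexx.
have ltac0 : 0 <= Num.max a c by rewrite le_max a0.
have min1 : Num.min b d <= 1 by rewrite ge_min b1.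
pose K := IntervalForecast (ex_intro _ (Num.max a c) (ex_intro _ (Num.min b d)
  (And4 ltac0 le_max_min min1 (erefl `[Num.max a c, Num.min b d]%classic)))).
have inK p : (K : set R) p = (Num.max a c <= p <= Num.min b d) by rewrite /= in_itv.
(* The two mixed cases are nestings, where [J] or [I] itself is the witness. In the last case the
   intervals cross the other way, so the roles of [I] and [J] are exchanged. *)
have [leac|ltca] := leP a c; have [lebd|ltdb] := leP b d.
- exists K; first by rewrite KE.
  apply: (schnorr_overlapping (b := b) (c := c)) randI randJ => [p|p||].
  + by rewrite inI => /andP[].
  + by rewrite inJ => /andP[].
  + by rewrite inK max_r // min_l // lecb lexx.
  + by rewrite inK max_r // min_l // lecb lexx.
- by exists J => //; rewrite KE JE max_r // min_r // ltW.
- by exists I => //; rewrite KE IE max_l ?(ltW ltca) // min_l.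
- exists K; first by rewrite KE.
  apply: (schnorr_overlapping (b := d) (c := a)) randJ randI => [p|p||].
  + by rewrite inJ => /andP[].
  + by rewrite inI => /andP[].
  + by rewrite inK max_l ?(ltW ltca) // min_r ?(ltW ltdb) // lead lexx.
  + by rewrite inK max_l ?(ltW ltca) // min_r ?(ltW ltdb) // lead lexx.
Qed.
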